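(* $$\operatorname{add}(\mathcal M)\le\operatorname{add}(\mathcal{MA})\quad\text{and}\quad \operatorname{cof}(\mathcal{MA})\le\operatorname{cov}\Big(\big([\operatorname{cof}(\mathcal M)]^{<\operatorname{add}(\mathcal M)}\big)^{\mathfrak d}\Big).$$
   Context: $\mathcal M$ is the ideal of meager subsets of ${}^\omega2$, where ${}^\omega 2$ is a topological group under coordinatewise addition modulo 2. $\mathcal{MA}$ is the $\sigma$-ideal of meager-additive sets: $X\subseteq{}^\omega2$ is in $\mathcal{MA}$ iff $X+A\in\mathcal M$ for every $A\in\mathcal M$. $\mathfrak d$ is the dominating number of $\langle{}^\omega\omega,\le^*\rangle$. For an ideal $\mathcal I$ on ${}^\omega2$: $\operatorname{add}(\mathcal I)$ is the least size of $\mathcal J\subseteq\mathcal I$ with $\bigcup\mathcal J\notin\mathcal I$; $\operatorname{cof}(\mathcal I)$ is the least size of a cofinal subset of $\langle\mathcal I,\subseteq\rangle$. For cardinals $\mu\le\kappa$ and $\nu$, $\operatorname{cov}\big(([\kappa]^{<\mu})^{\nu}\big)$ is the least size of a family $F$ of functions $A\colon\nu\to[\kappa]^{<\mu}$ such that every $x\in{}^{\nu}\kappa$ satisfies, for some $A\in F$, $x(i)\in A(i)$ for all $i<\nu$. *)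

(* Defs.v *)
From HB Require Import structures.
From mathcomp Require Import all_boot all_order all_algebra.
From mathcomp Require Import all_classical topology cantor.

Set Implicit Arguments.
Unset Strict Implicit.
Unset Printing Implicit Defensive.

Import Order.TTheory GRing.Theory.

Local Open Scope classical_set_scope.
Local Open Scope card_scope.
Local Open Scope ring_scope.

(* A cardinal is represented by a set of that cardinality, and cardinals are
   compared with #<=.  "The least size of an A such that P A" is a set A of
   least size among those satisfying P; by least_cardP it exists as soon as P
   is inhabited, and any two choices are equinumerous.  The value set0 is junk,
   taken only when P is empty. *)
Definition least_card T (P : set (set T)) : set T :=
  xget set0 [set A | P A /\ forall B, P B -> A #<= B].

Lemma least_cardP T (P : set (set T)) : P !=set0 ->
  P (least_card P) /\ forall B, P B -> least_card P #<= B.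
Proof.
move=> P0; rewrite /least_card; apply: (xgetPex set0 (P := [set A | P A /\ _])).
pose Q (S : set (set T -> T)) := forall f g, S f -> S g ->
  forall A, P A -> A (f A) /\ (f A = g A -> f = g).
have [F FQ Ftot|S [QS maxS]] := @Zorn_bigcup _ Q.
  move=> f g [X FX Xf] [Y FY Yg].
  by have [XY|YX] := Ftot _ _ FX FY;
    [exact: (FQ Y FY _ _ (XY _ Xf) Yg)|exact: (FQ X FX _ _ Xf (YX _ Yg))].
suff [A PA AS] : exists2 A, P A & forall t, A t -> exists2 f, S f & f A = t.
  exists A; split => // B PB; apply/card_leP.
  have /choice[h hP] : forall t : A, exists f, S f /\ f A = val t.
    by move=> t; have [f Sf fA] := AS _ (set_valP t); exists f.
  have hB t : B (h t B) by have [St _] := hP t; have [] := QS _ _ St St _ PB.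
  apply/injfunPex; exists (fun t => SigSub (mem_set (hB t))) => //.
  move=> s t _ _ [/=] hst; apply: val_inj.
  have [[Ss <-] [St <-]] := (hP s, hP t).
  by have [_ ->] := QS _ _ Ss St _ PB.
apply: contrapT => noA.
have miss A : P A -> exists t, A t /\ forall f, S f -> f A <> t.
  move=> PA; apply: contrapT => nA; apply: noA; exists A => // t At.
  apply: contrapT => nf; apply: nA; exists t; split => // f Sf fA.
  by apply: nf; exists f.
have [A0 PA0] := P0; have [t0 [_ t0S]] := miss _ PA0.
have /choice[g gP] : forall A, exists t, P A -> A t /\ forall f, S f -> f A <> t.
  by move=> A; have [/miss[t ?]|nPA] := pselect (P A); [exists t|exists t0].
apply: (maxS (S `|` [set g])).
  split=> [|/(_ g)Sg]; first by left.
  by have [_ /(_ g)] := gP _ PA0; apply=> //; apply: Sg; right.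
move=> f f' [Sf|->] [Sf'|->] A PA; have [gA gS] := gP A PA.
- exact: QS.
- by split=> [|/(gS _ Sf)//]; have [] := QS _ _ Sf Sf _ PA.
- by split=> // /esym/(gS _ Sf').
- by split.
Qed.

Definition card_lt T U (A : set T) (B : set U) := (A #<= B) && ~~ (B #<= A).
Notation "A '#<' B" := (card_lt A B) (at level 79) : card_scope.

Section Ideals.
Context {T : Type}.

Definition add_ideal (I : set (set T)) : set (set T) :=
  least_card [set J | J `<=` I /\ ~ I (\bigcup_(A in J) A)].

Definition cof_ideal (I : set (set T)) : set (set T) :=
  least_card [set J | J `<=` I /\ forall A, I A -> exists2 B, J B & A `<=` B].

End Ideals.

Definition eventually_le (f g : nat -> nat) := \forall n \near \oo, (f n <= g n)%N.

Definition dominating_number : set (nat -> nat) :=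
  least_card [set D | forall f, exists2 g, D g & eventually_le f g].

(* cov(([kappa]^{<mu})^nu); the sets kappa and nu are used as types. *)
Definition cov_pow T U V (kappa : set T) (mu : set U) (nu : set V) :
    set (nu -> set kappa) :=
  least_card [set F : set (nu -> set kappa) |
    (forall A, F A -> forall i, A i #< mu) /\
    (forall x : nu -> kappa, exists2 A, F A & forall i, A i (x i))].
Arguments cov_pow {T U V} kappa mu nu.

Definition nowhere_dense (X : topologicalType) (A : set X) :=
  interior (closure A) = set0.

Definition meager (X : topologicalType) : set (set X) :=
  [set A | exists2 F : nat -> set X,
     (forall n, nowhere_dense (F n)) & A = \bigcup_n F n].

(* bool is a Z-module under addb, so this is addition modulo 2. *)
HB.instance Definition _ := GRing.Zmodule.copy cantor_space (nat -> bool).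

Lemma cantor_addE (x y : cantor_space) n : (x + y) n = x n (+) y n.
Proof. by []. Qed.

Definition meager_additive : set (set cantor_space) :=
  [set X : set cantor_space | forall A : set cantor_space,
     meager A -> meager [set x + a | x in X & a in A]].

(* Main.v *)
Require Import Defs.
From mathcomp Require Import all_boot all_order all_algebra.
From mathcomp Require Import all_classical topology cantor.

Set Implicit Arguments.
Unset Strict Implicit.

Local Open Scope classical_set_scope.
Local Open Scope card_scope.

(** The proof rests on a family of meager sets that is generating up to
translation.  For g : nat -> nat let W(g) be the set of all z that are nonzero
somewhere on [m, g m) for all but finitely many m.  Each W(g) is meager, W(g)
grows with g modulo finite, and every meager set is contained in some
x + W(h) ([meager_sub_translate_nonzero_windows]).  The meager ideal is
invariant under translation, so X is meager-additive as soon as X + W(g) is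
meager for all g in one dominating family ([meager_additive_dominating]): a
dominating number of tests suffices.

The bound on the cofinality follows.  Fix a cofinal family C of meager sets and
a dominating family D, both of least size.  A meager-additive X determines a
function x from D to C with X + W(d) contained in x(d).  If A(d) contains x(d)
and has fewer than add(M) elements, then the union of A(d) is still meager, so
the set Y(A) of all z such that z + W(d) is contained in that union for every d
in D is meager-additive, and it contains X.  Hence the sets Y(A), for A in a
covering family, are cofinal in the meager-additive ideal.

The bound on the additivity is direct: if the union of a family of
meager-additive sets is not meager-additive, this is witnessed by a meager A, and
adding A to each member of the family gives at most as many meager sets whose
union is not meager.

Least cardinals of empty classes are junk, so both arguments also need the
classes at hand to be inhabited.  This is where the Baire category theorem
enters ([nonmeager_setT]), as it does in the construction of x and h above. *)

(** * Nowhere dense sets in terms of finite prefixes *)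

Definition agree (m : nat) (x y : cantor_space) :=
  forall i, (i < m)%N -> x i = y i.

Lemma agree_leq m n x y : (m <= n)%N -> agree n x y -> agree m x y.
Proof. by move=> mn xy i im; apply: xy; exact: leq_trans mn. Qed.

Lemma cantor_addK (t x : cantor_space) : (x + t + t)%R = x.
Proof. by apply/funext => i; rewrite !cantor_addE addbK. Qed.

Lemma agree_add m (x y t : cantor_space) :
  agree m x y -> agree m (x + t)%R (y + t)%R.
Proof. by move=> xy i im; rewrite !cantor_addE xy. Qed.

(** If no cylinder around x were contained in A, points outside A agreeing with
x on longer and longer prefixes would converge to x. *)
Lemma nbhs_cantorP (x : cantor_space) (A : set cantor_space) :
  nbhs x A <-> exists m, forall y, agree m x y -> A y.
Proof.
split=> [xA|[m mA]].
  apply: contrapT => noA.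
  have /choice[u uP] : forall m, exists y, agree m x y /\ ~ A y.
    move=> m; apply: contrapT => nm; apply: noA; exists m => y xy.
    by apply: contrapT => nAy; apply: nm; exists y.
  have ux : u @ \oo --> x.
    apply/cvg_sup => N U [V] [[W] oW <-] WxN WU.
    apply: (@filterS _ (u @ \oo) _ _ _ WU); exists N.+1 => // i /= Ni.
    by have [/(_ N Ni) <-] := uP i.
  have [N _ /(_ N (leqnn N))] := ux _ xA.
  by have [] := uP N.
suff mx : nbhs x [set y | agree m x y].
  by apply: (@filterS _ _ (nbhs_filter x) _ _ _ mx) => y /mA.
elim: m {mA} => [|m IHm]; first exact: (@filterE _ _ (nbhs_filter x)).
have xm : nbhs x [set y : cantor_space | y m = x m].
  have /(_ [set b | b = x m]) := @proj_continuous _ (fun _ : nat => bool) m x.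
  apply; apply: open_nbhs_nbhs; split => //; exact: discrete_open.
apply: (@filterS2 _ _ (nbhs_filter x) _ _ _ _ IHm xm) => y /= xy ym i.
by rewrite ltnS leq_eqVlt; case/orP => [/eqP ->//|/xy].
Qed.

(** The cylinder of length k around y is a subcylinder of the one of length m
around x; the bound m <= k is what lets such refinements be iterated. *)
Lemma nowhere_denseP (A : set cantor_space) :
  nowhere_dense A <-> forall x m, exists y k,
    [/\ (m <= k)%N, agree m x y & forall z, agree k y z -> ~ A z].
Proof.
split=> [A0 x m|AP].
  have : ~ interior (closure A) x by rewrite A0.
  move=> nx; apply: contrapT => nyk; apply: nx.
  apply/nbhs_cantorP; exists m => y xy B /nbhs_cantorP[k kB].
  apply: contrapT => AB0; apply: nyk; exists y, (maxn m k).
  split => // [|z yz Az]; first exact: leq_maxl.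
  apply: AB0; exists z; split=> //; apply: kB.
  by apply: agree_leq yz; rewrite leq_maxr.
rewrite /nowhere_dense -subset0 => x /nbhs_cantorP[m mA].
have [y [k [_ /mA yA kA]]] := AP x m.
have [|z [Az yz]] := yA [set z | agree k y z]; last exact: kA Az.
by apply/nbhs_cantorP; exists k.
Qed.

Lemma nowhere_dense_sub (A B : set cantor_space) :
  A `<=` B -> nowhere_dense B -> nowhere_dense A.
Proof.
move=> AB /nowhere_denseP BP; apply/nowhere_denseP => x m.
by have [y [k [mk xy yB]]] := BP x m; exists y, k; split => // z /yB + /AB.
Qed.

Lemma nowhere_denseU (A B : set cantor_space) :
  nowhere_dense A -> nowhere_dense B -> nowhere_dense (A `|` B).
Proof.
move=> /nowhere_denseP AP /nowhere_denseP BP; apply/nowhere_denseP => x m.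
have [y [k [mk xy yA]]] := AP x m; have [z [l [kl yz zB]]] := BP y k.
exists z, l; split; first exact: leq_trans kl.
  by move=> i im; rewrite xy // yz //; exact: leq_trans mk.
move=> w zw [|]; last exact: zB.
by apply: yA => i ik; rewrite yz // zw //; exact: leq_trans kl.
Qed.

Lemma nowhere_dense_translate (t : cantor_space) A :
  nowhere_dense A -> nowhere_dense [set z | A (z + t)%R].
Proof.
move=> /nowhere_denseP AP; apply/nowhere_denseP => x m.
have [y [k [mk xy yA]]] := AP (x + t)%R m.
exists (y + t)%R, k; split=> // [|z yz /=]; last first.
  by apply: yA; rewrite -[y](cantor_addK t); exact: agree_add.
by rewrite -[x](cantor_addK t); exact: agree_add.
Qed.

(** * Meager sets *)

Lemma meager_sub (A B : set cantor_space) : A `<=` B -> meager B -> meager A.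
Proof.
move=> AB [F Fnd BE]; exists (fun n => F n `&` A).
  by move=> n; exact: nowhere_dense_sub (Fnd n).
by rewrite -setI_bigcupl -BE; apply/esym/setIidPr.
Qed.

Lemma meager_translate (t : cantor_space) A :
  meager A -> meager [set z | A (z + t)%R].
Proof.
move=> [F Fnd ->]; exists (fun n => [set z | F n (z + t)%R]) => //.
by move=> n; exact: nowhere_dense_translate.
Qed.

(** The Baire category theorem for the Cantor space: successive cylinders, the
n-th step avoiding F n, shrink to a point outside all the F n. *)
Lemma nonmeager_setT : ~ meager [set: cantor_space].
Proof.
move=> [F Fnd FT].
have /choice[f fP] (p : nat * (cantor_space * nat)) :
    exists q : cantor_space * nat,
    [/\ (p.2.2 < q.2)%N, agree p.2.2 p.2.1 q.1 &
        forall z, agree q.2 q.1 z -> ~ F p.1 z].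
  have /nowhere_denseP/(_ p.2.1 p.2.2.+1)[y [k [pk py yF]]] := Fnd p.1.
  by exists (y, k); split => //; exact: agree_leq py.
pose fix s n := if n is m.+1 then f (m, s m) else (point, 0).
have sS n : [/\ ((s n).2 < (s n.+1).2)%N, agree (s n).2 (s n).1 (s n.+1).1 &
    forall z, agree (s n.+1).2 (s n.+1).1 z -> ~ F n z] := fP (n, s n).
have s_ge n : (n <= (s n).2)%N.
  by elim: n => // n IHn; have [+ _ _] := sS n; exact: leq_ltn_trans.
have s_agree m n : (m <= n)%N ->
    ((s m).2 <= (s n).2)%N /\ agree (s m).2 (s m).1 (s n).1.
  elim: n => [|n IHn]; first by rewrite leqn0 => /eqP ->; split.
  rewrite leq_eqVlt => /predU1P[->//|/IHn[le_mn mn]].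
  have [lt_n nn _] := sS n; split; first exact: leq_trans le_mn (ltnW lt_n).
  by move=> i im; rewrite mn // nn //; exact: leq_trans le_mn.
(* The prefix fixed at stage i.+1 has length more than i, so bit i of the
   limit can be read there. *)
pose x : cantor_space := fun i => (s i.+1).1 i.
have : (\bigcup_n F n) x by rewrite -FT.
move=> [n _ Fx]; have [_ _ /(_ x)] := sS n; apply => // i ni.
rewrite /x; have [/s_agree[_ +]|/ltnW/s_agree[_ +]] := leqP n.+1 i.+1.
  by apply.
by move=> ->//; exact: s_ge.
Qed.

(** * Meager sets generated by window functions *)

Definition tail_saturation m (A : set cantor_space) : set cantor_space :=
  [set z | exists2 w, A w & forall i, (m <= i)%N -> z i = w i].

(** Up to position m only finitely many modifications are possible; each new
position adds one translate, by the unit vector at that position. *)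
Lemma nowhere_dense_tail_saturation m A :
  nowhere_dense A -> nowhere_dense (tail_saturation m A).
Proof.
move=> And; elim: m => [|m IHm].
  apply: nowhere_dense_sub And => z [w Aw zw].
  by rewrite (_ : z = w) //; apply/funext => i; exact: zw.
pose e : cantor_space := fun i => i == m.
apply: nowhere_dense_sub (nowhere_denseU IHm (nowhere_dense_translate e IHm)).
move=> z [w Aw zw]; have [zwm|zwm] := eqVneq (z m) (w m); [left|right].
  exists w => // i; rewrite leq_eqVlt => /predU1P[<-//|]; exact: zw.
exists w => // i; rewrite cantor_addE /e leq_eqVlt => /predU1P[<-|mi].
  by rewrite eqxx; case: (z m) (w m) zwm => -[].
by rewrite gtn_eqF // addbF zw.
Qed.

(** Stronger than x not being in A: only the bits of x in the window [m, k)
count, so the property is open in x and insensitive to the bits below m. *)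
Definition dodges (A : set cantor_space) (x : cantor_space) m k :=
  forall z, A z -> exists2 i, (m <= i < k)%N & z i != x i.

(** A cylinder that avoids the tail saturation of A at m avoids A regardless
of the bits below m, so the bits from m up to its length suffice. *)
Lemma nowhere_dense_never_dodges m A : nowhere_dense A ->
  nowhere_dense [set x | ~ exists k, dodges A x m k].
Proof.
move=> /(nowhere_dense_tail_saturation m)/nowhere_denseP AP.
apply/nowhere_denseP => x l; have [y [k [lk xy yA]]] := AP x l.
exists y, k; split=> // z yz; apply; exists k => w Aw.
apply: contrapT => zw.
(* If w agreed with z on the whole window, v would be in the tail saturation
   of A, because of w, and in the cylinder avoiding it. *)
pose v : cantor_space := fun i => if (i < k)%N then z i else w i.
apply: (yA v) => [i ik|]; first by rewrite yz // /v ik.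
exists w => // i mi; rewrite /v; case: ifPn => // ik.
apply/esym/eqP; apply: contrapT => /negP wz; apply: zw.
by exists i; rewrite ?mi.
Qed.

Definition nonzero_windows (g : nat -> nat) : set cantor_space :=
  [set z | \forall m \near \oo, exists2 i, (m <= i < g m)%N & z i].

Lemma nonzero_windows_le f g :
  eventually_le f g -> nonzero_windows f `<=` nonzero_windows g.
Proof.
move=> fg z; apply: filterS2 fg => m fgm [i /andP[mi im] zi].
by exists i; rewrite // mi (leq_trans im).
Qed.

(** With the threshold N for the windows fixed, extending a prefix by zeros up
to the end of a later window leaves the set. *)
Lemma meager_nonzero_windows g : meager (nonzero_windows g).
Proof.
exists (fun N => [set z : cantor_space | forall m, (N <= m)%N ->
    exists2 i, (m <= i < g m)%N & z i]); last first.
  by apply/seteqP; split=> z [N _ zN]; exists N.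
move=> N; apply/nowhere_denseP => x m; set M := maxn m N.
pose y : cantor_space := fun i => (i < m)%N && x i.
exists y, (maxn m (g M)); split; first exact: leq_maxl.
  by move=> i im; rewrite /y im.
move=> z yz /(_ M (leq_maxr _ _))[i /andP[Mi ig]].
rewrite -yz ?leq_max ?ig ?orbT // /y ltnNge.
by rewrite (leq_trans (leq_maxl m N) Mi).
Qed.

(** Write A as the union of nowhere dense sets F k.  By Baire category some x
dodges, from every m on, the finite union of the F k with k <= m; let h m be the
end of the window used.  A point of F n then differs from x on [m, h m) for all
m >= n. *)
Lemma meager_sub_translate_nonzero_windows (A : set cantor_space) : meager A ->
  exists x h, forall z, A z -> nonzero_windows h (z + x)%R.
Proof.
move=> [F Fnd ->].
have FUnd m : nowhere_dense (\bigcup_(k in `I_m.+1) F k).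
  elim: m => [|m IHm].
    by apply: nowhere_dense_sub (Fnd 0) => z [k /=]; case: k.
  apply: nowhere_dense_sub (nowhere_denseU IHm (Fnd m.+1)).
  move=> z [k /=]; rewrite ltnS leq_eqVlt => /predU1P[->|km] Fz; first by right.
  by left; exists k.
have [x /choice[h hP]] : exists x, forall m, exists k,
    dodges (\bigcup_(k in `I_m.+1) F k) x m k.
  apply: contrapT => nx; apply: nonmeager_setT.
  exists (fun m => [set y | ~ exists k,
      dodges (\bigcup_(k in `I_m.+1) F k) y m k]).
    by move=> m; exact: nowhere_dense_never_dodges (FUnd m).
  apply/esym; rewrite -subTset => x _; apply: contrapT => xm; apply: nx.
  exists x => m; apply: contrapT => nk; apply: xm; by exists m.
exists x, h => z [n _ Fz]; exists n => // m /= nm.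
have [|i mi zx] := hP m z; first by exists n.
by exists i => //; rewrite cantor_addE -negb_eqb.
Qed.

(** * The meager-additive ideal *)

Lemma meager_additive_sub X Y :
  X `<=` Y -> meager_additive Y -> meager_additive X.
Proof.
move=> XY Yma A /Yma; apply: meager_sub => z [x Xx [a Aa <-]].
by exists x; [exact: XY|exists a].
Qed.

(** A meager set A lies in some t + W(h), and W(h) lies in W(g) for some g in
D, so X + A lies in the translate by t of X + W(g). *)
Lemma meager_additive_dominating D X :
  (forall f, exists2 g, D g & eventually_le f g) ->
  (forall g, D g -> meager [set x + a | x in X & a in nonzero_windows g]%R) ->
  meager_additive X.
Proof.
move=> Ddom XD A /meager_sub_translate_nonzero_windows[t [h Ah]].
have [g Dg hg] := Ddom h; apply: meager_sub (meager_translate t (XD g Dg)).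
move=> z [x Xx [a Aa <-]] /=; rewrite -GRing.addrA; exists x => //.
by exists (a + t)%R => //; exact: (nonzero_windows_le hg (Ah _ Aa)).
Qed.

Lemma meager_additive_set1 x : meager_additive [set x].
Proof.
move=> A mA; apply: meager_sub (meager_translate x mA).
by move=> z [_ -> [a Aa <-]] /=; rewrite [(x + a)%R]GRing.addrC cantor_addK.
Qed.

(** Adding W(S) to the whole space gives the whole space, since W(S) contains
the constant sequence of ones. *)
Lemma not_meager_additive_setT : ~ meager_additive [set: cantor_space].
Proof.
move=> /(_ _ (meager_nonzero_windows S)) mT; apply: nonmeager_setT.
apply: meager_sub mT => z _; pose a : cantor_space := fun=> true.
exists (z + a)%R => //; exists a; last exact: cantor_addK.
by apply: nearW => m; exists m; rewrite ?leqnn ?ltnSn.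
Qed.

(** If A witnesses that the union of J is not meager-additive, then J' consists
of the sets X + A with X in J.  Besides the inequality of additivities, this
shows that some family of meager sets has a nonmeager union. *)
Lemma nonmeager_bigcup_of_meager_additive (J : set (set cantor_space)) :
  J `<=` meager_additive -> ~ meager_additive (\bigcup_(X in J) X) ->
  exists J' : set (set cantor_space), [/\ J' `<=` @meager cantor_space,
    ~ meager (\bigcup_(A in J') A) & J' #<= J].
Proof.
move=> JMA /existsNP[A /not_implyP[mA nmJA]].
pose plusA (X : set cantor_space) := [set x + a | x in X & a in A]%R.
exists (plusA @` J); split; last exact: card_image_le.
  by move=> _ [X /JMA XMA <-]; exact: XMA.
apply: contra_not nmJA; apply: meager_sub => z [x [X JX Xx] [a Aa <-]].
by exists (plusA X); [exists X|exists x => //; exists a].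
Qed.

(** * Cardinal invariants of the two ideals *)

Lemma add_ideal_meager_additiveP :
  [/\ add_ideal meager_additive `<=` meager_additive &
      ~ meager_additive (\bigcup_(X in add_ideal meager_additive) X)].
Proof.
have [|[JMA nJ] _] := @least_cardP _ [set J | J `<=` meager_additive /\
    ~ meager_additive (\bigcup_(X in J) X)]; last by split.
exists (range set1); split.
  by move=> _ [x _ <-]; exact: meager_additive_set1.
apply: contra_not not_meager_additive_setT; apply: meager_additive_sub.
by move=> x _; exists [set x] => //; exists x.
Qed.

Lemma add_meagerP :
  [/\ add_ideal (@meager cantor_space) `<=` @meager cantor_space,
      ~ meager (\bigcup_(A in add_ideal (@meager cantor_space)) A) &
      forall J : set (set cantor_space), J `<=` @meager cantor_space ->
        ~ meager (\bigcup_(A in J) A) -> add_ideal (@meager cantor_space) #<= J].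
Proof.
have [JMA nJ] := add_ideal_meager_additiveP.
have [|[Jm nJm] minJ] := @least_cardP _ [set J | J `<=` @meager cantor_space /\
    ~ meager (\bigcup_(A in J) A)].
  by have [J' [J'm nJ' _]] := nonmeager_bigcup_of_meager_additive JMA nJ; exists J'.
by split=> // J Jsub nmJ; exact: minJ.
Qed.

Lemma add_meager_le_add_meager_additive :
  add_ideal (@meager cantor_space) #<= add_ideal meager_additive.
Proof.
have [JMA nJ] := add_ideal_meager_additiveP; have [_ _ addM] := add_meagerP.
have [J' [J'm nJ' J'J]] := nonmeager_bigcup_of_meager_additive JMA nJ.
by apply: card_le_trans J'J; exact: addM.
Qed.

(** The union of at most one meager set is meager, so add(M) is at least 2.
This makes singletons small enough to be values of a covering family. *)
Lemma set1_lt_add_meager T (t : T) :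
  [set t] #< add_ideal (@meager cantor_space).
Proof.
have [Jm nJ _] := add_meagerP; set J := add_ideal _ in Jm nJ *.
have [A JA] : exists A, J A.
  apply: contrapT => /forallNP J0; apply: nJ.
  apply: meager_sub (meager_nonzero_windows S).
  by move=> z [A /J0].
apply/andP; split.
  apply: card_le_trans (subset_card_le (_ : [set A] `<=` J)); last by move=> _ ->.
  by have := card_image_le (fun=> t) [set A]; rewrite image_set1.
apply/negP => /card_leP[f]; apply: nJ; apply: meager_sub (Jm A JA).
move=> z [B JB Bz]; suff <- : B = A by [].
have fE b : val (f b) = t by exact: set_valP (f b).
have /(congr1 val)//= : SigSub (mem_set JB) = SigSub (mem_set JA) :> J.
by apply: (@inj _ _ _ f); rewrite ?inE //; apply: val_inj; rewrite !fE.
Qed.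

Lemma cof_meagerP :
  [/\ cof_ideal (@meager cantor_space) `<=` @meager cantor_space &
      forall A, meager A ->
        exists2 B, cof_ideal (@meager cantor_space) B & A `<=` B].
Proof.
have [|[Jm cofJ] _] := @least_cardP _ [set J | J `<=` @meager cantor_space /\
    forall A, meager A -> exists2 B, J B & A `<=` B]; last by split.
by exists (@meager cantor_space); split=> // A mA; exists A.
Qed.

Lemma dominating_numberP f :
  exists2 g, dominating_number g & eventually_le f g.
Proof.
have [|domD _] := @least_cardP _ [set D | forall f, exists2 g, D g &
    eventually_le f g]; last exact: domD.
by exists setT => f'; exists f' => //; exact: nearW.
Qed.

(** Functions with singleton values cover everything, so covering families
exist once singletons are smaller than mu. *)
Lemma cov_powP T U V (kappa : set T) (mu : set U) (nu : set V) :
  (forall t : kappa, [set t] #< mu) ->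
  (forall A, cov_pow kappa mu nu A -> forall i, A i #< mu) /\
  (forall x : nu -> kappa, exists2 A, cov_pow kappa mu nu A &
     forall i, A i (x i)).
Proof.
move=> mu1; have [|] := @least_cardP _ [set F : set (nu -> set kappa) |
    (forall A, F A -> forall i, A i #< mu) /\
    (forall x : nu -> kappa, exists2 A, F A & forall i, A i (x i))]; last by [].
exists (range (fun (x : nu -> kappa) i => [set x i])); split.
  by move=> _ [x _ <-] i; exact: mu1.
by move=> x; exists (fun i => [set x i]) => //; exists x.
Qed.

Lemma meager_bigcup_lt_add (E : set (cof_ideal (@meager cantor_space))) :
  E #< add_ideal (@meager cantor_space) -> meager (\bigcup_(B in E) val B).
Proof.
move=> /andP[_ /negP ltE]; apply: contrapT => nE; apply: ltE.
have [_ _ addM] := add_meagerP; have [cofM _] := cof_meagerP.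
apply: card_le_trans (card_image_le val E); apply: addM.
  by move=> _ [B _ <-]; apply: cofM; exact: set_valP.
by rewrite bigcup_image.
Qed.

Lemma cof_meager_additive_le_cov_pow :
  cof_ideal meager_additive #<=
    cov_pow (cof_ideal (@meager cantor_space))
      (add_ideal (@meager cantor_space)) dominating_number.
Proof.
set F := cov_pow _ _ _.
have [Flt Fcov] := @cov_powP _ _ _ (cof_ideal (@meager cantor_space)) _
  dominating_number (fun t => set1_lt_add_meager t).
have [_ cofM] := cof_meagerP.
pose W (d : dominating_number) := nonzero_windows (val d).
pose Y (A : dominating_number -> set (cof_ideal (@meager cantor_space))) :=
  [set x : cantor_space | forall d a, W d a ->
     (\bigcup_(B in A d) val B) (x + a)%R].
have YMA A : F A -> meager_additive (Y A).
  move=> FA; apply: meager_additive_dominating dominating_numberP _ => g Dg.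
  apply: meager_sub (meager_bigcup_lt_add (Flt A FA (SigSub (mem_set Dg)))).
  by move=> z [x Yx [a Wa <-]]; exact: Yx.
have cofY X : meager_additive X -> exists2 A, F A & X `<=` Y A.
  move=> XMA; have /choice[x xP] : forall d,
      exists B : cof_ideal (@meager cantor_space),
      [set x + a | x in X & a in W d]%R `<=` val B.
    move=> d; have [B cofB XB] := cofM _ (XMA _ (meager_nonzero_windows (val d))).
    by exists (SigSub (mem_set cofB)).
  have [A FA Ax] := Fcov x; exists A => // z Xz d a Wa.
  by exists (x d) => //; apply: xP; exists z => //; exists a.
apply: card_le_trans (card_image_le Y F).
have [|_ minJ] := @least_cardP _ [set J | J `<=` meager_additive /\
    forall X, meager_additive X -> exists2 Z, J Z & X `<=` Z]; last first.
  apply: minJ; split; first by move=> _ [A FA <-]; exact: YMA.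
  by move=> X /cofY[A FA XA]; exists (Y A) => //; exists A.
by exists meager_additive; split=> // X XMA; exists X.
Qed.

Theorem corollary1p10 :
  add_ideal (@meager cantor_space) #<= add_ideal meager_additive /\
  cof_ideal meager_additive #<=
    cov_pow (cof_ideal (@meager cantor_space))
      (add_ideal (@meager cantor_space)) dominating_number.
Proof.
split; first exact: add_meager_le_add_meager_additive.
exact: cof_meager_additive_le_cov_pow.
Qed.
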